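(* Let $G$ be an $r$-uniform hypergraph with at least one edge. Then $\log\lambda^{(p)}(G)$ is a convex (concave upward) function of $1/p$ for $p>r$; that is, the function $t\mapsto\log\lambda^{(1/t)}(G)$ is convex on the interval $(0,1/r)$.
   Context: An $r$-uniform hypergraph $G$ consists of a finite vertex set $V(G)=\{1,\dots,n\}$ and a set $E(G)$ of $r$-element subsets of $V(G)$ (edges). For $\bm{x}\in\mathbb{R}^n$ let $P_G(\bm{x})=r\sum_{\{i_1,\ldots,i_r\}\in E(G)}x_{i_1}\cdots x_{i_r}$, and for real $p\ge1$ let $\|\bm{x}\|_p=(|x_1|^p+\cdots+|x_n|^p)^{1/p}$. The $p$-spectral radius of $G$ is $\lambda^{(p)}(G)=\max_{\|\bm{x}\|_p=1}P_G(\bm{x})$. *)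

(* Defs.v *)
From HB Require Import structures.
From mathcomp Require Import all_boot all_order all_algebra.
From mathcomp Require Import all_classical all_reals all_analysis.

Set Implicit Arguments.
Unset Strict Implicit.
Unset Printing Implicit Defensive.

Import Order.TTheory GRing.Theory Num.Theory.
Import numFieldNormedType.Exports.

Local Open Scope classical_set_scope.
Local Open Scope ring_scope.

Record uhypergraph (n r : nat) := UHypergraph {
  edges : {set {set 'I_n}};
  edges_uniform : forall e, e \in edges -> #|e| = r }.

Definition polyform (R : realType) (n r : nat) (G : uhypergraph n r)
    (x : 'rV[R]_n) : R :=
  r%:R * \sum_(e in edges G) \prod_(i in e) x ord0 i.

Definition pnorm (R : realType) (n : nat) (p : R) (x : 'rV[R]_n) : R :=
  (\sum_(i < n) `|x ord0 i| `^ p) `^ p^-1.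

(* For n > 0 and p >= 1 this supremum is a maximum: see spectral_radius_max. *)
Definition spectral_radius (R : realType) (n r : nat) (G : uhypergraph n r)
    (p : R) : R :=
  sup [set polyform G x | x in [set x : 'rV[R]_n | pnorm p x = 1]].

Lemma continuous_norm_powR (R : realType) (p : R) (p0 : 0 < p) :
  continuous (fun a : R => `|a| `^ p).
Proof.
move=> a; have [->|a0] := eqVneq a 0.
  rewrite /continuous_at normr0 powR0 ?gt_eqF//.
  apply/cvgrPdist_lt => e e0; near=> b.
  rewrite sub0r normrN ger0_norm ?powR_ge0//.
  rewrite -[ltRHS](powRr1 (ltW e0)) -(mulVf (lt0r_neq0 p0)) powRrM.
  rewrite gt0_ltr_powR ?nnegrE ?powR_ge0//.
  near: b.
  exact: (@pseudometric_normed_Zmodule.nbhs0_lt R R (e `^ p^-1) (powR_gt0 _ e0)).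
apply: (@continuous_comp _ _ _ (fun b : R => `|b|) (fun b : R => b `^ p)).
  exact: norm_continuous.
apply/differentiable_continuous/derivable1_diffP.
by apply: derivable_powR; rewrite in_itv/= andbT normr_gt0.
Unshelve. all: by end_near. Qed.

Lemma pnorm_eq1 (R : realType) (n : nat) (p : R) (p0 : 0 < p) (x : 'rV[R]_n) :
  (pnorm p x = 1) <-> (\sum_(i < n) `|x ord0 i| `^ p = 1).
Proof.
rewrite /pnorm; split=> [h|->]; last by rewrite powR1.
apply: (@powR_injective _ p^-1); rewrite ?invr_gt0 ?nnegrE//.
- by apply: sumr_ge0 => i _; exact: powR_ge0.
- by rewrite h powR1.
Qed.

Lemma spectral_radius_max (R : realType) (n r : nat) (G : uhypergraph n r)
    (p : R) : (0 < n)%N -> 1 <= p ->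
  exists2 x : 'rV[R]_n, pnorm p x = 1 &
    polyform G x = spectral_radius G p /\
    forall y : 'rV[R]_n, pnorm p y = 1 -> polyform G y <= polyform G x.
Proof.
move=> n0 p1; have p0 : 0 < p by exact: lt_le_trans p1.
set S := [set x : 'rV[R]_n | pnorm p x = 1].
have SE : S = (fun x : 'rV[R]_n => \sum_(i < n) `|x ord0 i| `^ p) @^-1` [set 1].
  by apply/seteqP; split=> x /(pnorm_eq1 p0).
have S0 : S !=set0.
  exists (\row_j (j == Ordinal n0)%:R); apply/(pnorm_eq1 p0).
  rewrite (bigD1 (Ordinal n0))//= mxE eqxx normr1 powR1 big1 ?addr0//.
  by move=> i /negbTE iN; rewrite mxE iN normr0 powR0 ?gt_eqF.
have cS : compact S.
  apply: bounded_closed_compact; last first.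
    rewrite SE; apply: preimage_closed; last exact: closed_eq.
    move=> x _; move: x.
    apply: continuous_big => [|i _]; first exact: add_continuous.
    move=> x.
    apply: (@continuous_comp _ _ _ (fun y : 'rV[R]_n => y ord0 i)
      (fun b : R => `|b| `^ p)); first exact: coord_continuous.
    exact: continuous_norm_powR.
  exists 1; split => // M M1 x /(pnorm_eq1 p0) xS.
  apply: le_trans (ltW M1); rewrite [leLHS]/Num.norm /= mx_normrE.
  apply/bigmax_leP; split => // -[i j] _ /=; rewrite ord1.
  rewrite leNgt; apply/negP => x1.
  suff: 1 < \sum_(i < n) `|x ord0 i| `^ p by rewrite xS ltxx.
  rewrite (bigD1 j)//= ltr_wpDr//;
    first by apply: sumr_ge0 => k _; exact: powR_ge0.
  have := gt0_ltr_powR p0 _ _ x1; rewrite powR1.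
  by apply; rewrite nnegrE.
have cP : continuous (polyform G : 'rV[R]_n -> R).
  move=> x; rewrite /polyform.
  apply: (@cvgMl_tmp _ _ (nbhs x)); move: x.
  apply: continuous_big => [|e _]; first exact: add_continuous.
  apply: continuous_big => [|i _]; first exact: mul_continuous.
  exact: coord_continuous.
have [x xS xmax] := compact_EVT_max S0 cS (continuous_subspaceT cP).
exists x; first by move: xS; rewrite inE.
split=> [|y yS]; last by apply: xmax; rewrite inE.
apply/eqP; rewrite eq_le; apply/andP; split.
  apply: ub_le_sup; last by exists x => //; rewrite inE in xS.
  by exists (polyform G x) => _ [y yS <-]; apply: xmax; rewrite inE.
apply: ge_sup; first by have [y yS] := S0; exists (polyform G y), y.
by move=> _ [y yS <-]; apply: xmax; rewrite inE.
Qed.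

(* Main.v *)
Require Import Defs.
From mathcomp Require Import all_boot all_order all_algebra ring.
From mathcomp Require Import all_classical all_reals all_analysis.

(* If y_i = |x_i|^p, then ||x||_p = 1 means that y lies in the standard simplex,
   which does not depend on p, and, with t = 1/p, the form at the nonnegative
   vector y^t is a combination of the exponentials (prod_(i in e) y_i)^t with
   nonnegative coefficients, hence log-convex in t by Hoelder's inequality.
   Maximizing over the simplex preserves log-convexity. *)

Import Order.TTheory GRing.Theory Num.Theory.

Local Open Scope classical_set_scope.
Local Open Scope ring_scope.

Lemma powR_conv_le (R : realType) (k : {i01 R}) (u v : R) :
  0 <= u -> 0 <= v ->
  u `^ k%:num * v `^ (1 - k%:num) <= k%:num * u + (1 - k%:num) * v.
Proof.
move=> u0 v0.
have k0 : 0 <= k%:num by [].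
have k1 : 0 <= 1 - k%:num by rewrite subr_ge0.
move: u0; rewrite le_eqVlt => /predU1P[<-|u0].
  have [k00|kN0] := eqVneq k%:num 0.
    by rewrite k00 powRr0 subr0 powRr1// mul0r add0r.
  by rewrite powR0// mul0r mulr0 add0r mulr_ge0.
move: v0; rewrite le_eqVlt => /predU1P[<-|v0].
  have [k10|kN1] := eqVneq (1 - k%:num) 0.
    move/subr0_eq: k10 => <-.
    by rewrite subrr powRr0 (powRr1 (ltW u0)) mul0r addr0 mul1r mulr1.
  by rewrite (@powR0 R (1 - _))// !mulr0 addr0 mulr_ge0// (ltW u0).
have := convex_expR k (ln u) (ln v).
rewrite !convRE !lnK ?posrE// => h; apply: le_trans h.
by rewrite expRD /powR !gt_eqF.
Qed.

Lemma powR_mul_div (R : realType) (u v k : R) :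
  0 < v -> 0 <= u -> v `^ k * (u / v) `^ k = u `^ k.
Proof.
move=> v0 u0; have uv0 : 0 <= u / v by rewrite divr_ge0 // ltW.
by rewrite -(powRM _ (ltW v0) uv0) mulrCA mulfV ?gt_eqF// mulr1.
Qed.

Lemma powR_conv_le_scaled (R : realType) (k : {i01 R}) (w a b A B : R) :
  0 <= w -> 0 < A -> 0 < B -> k%:num * a + (1 - k%:num) * b != 0 ->
  w `^ (k%:num * a + (1 - k%:num) * b) <=
  A `^ k%:num * B `^ (1 - k%:num) *
    (k%:num * (w `^ a / A) + (1 - k%:num) * (w `^ b / B)).
Proof.
move=> w0 A0 B0 t0.
have -> : w `^ (k%:num * a + (1 - k%:num) * b) =
    A `^ k%:num * B `^ (1 - k%:num) *
      ((w `^ a / A) `^ k%:num * (w `^ b / B) `^ (1 - k%:num)).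
  rewrite mulrACA (powR_mul_div _ _ _ _ A0 (powR_ge0 _ _)).
  rewrite (powR_mul_div _ _ _ _ B0 (powR_ge0 _ _)) -!powRrM.
  (* [powRD] at base 0 needs a nonzero total exponent, which is [t0]. *)
  rewrite [a * _]mulrC [b * _]mulrC powRD//.
  by rewrite (negbTE t0).
rewrite ler_wpM2l ?mulr_ge0 ?powR_ge0//.
by apply: powR_conv_le; rewrite divr_ge0 ?powR_ge0 ?(ltW A0) ?(ltW B0).
Qed.

(** Hoelder's inequality with upper bounds [A] and [B] in place of the two sums: after the scaled
    AM-GM is summed termwise, both normalised sums are at most 1, and so is their convex
    combination. *)
Lemma sum_powR_conv_le (R : realType) (I : finType) (E : {set I}) (k : {i01 R})
    (w : I -> R) (a b c A B : R) :
  0 <= c -> 0 < A -> 0 < B -> k%:num * a + (1 - k%:num) * b != 0 ->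
  (forall e, 0 <= w e) ->
  c * \sum_(e in E) w e `^ a <= A -> c * \sum_(e in E) w e `^ b <= B ->
  c * \sum_(e in E) w e `^ (k%:num * a + (1 - k%:num) * b) <=
  A `^ k%:num * B `^ (1 - k%:num).
Proof.
move=> c0 A0 B0 t0 w0 hA hB.
have C0 : 0 <= A `^ k%:num * B `^ (1 - k%:num) by rewrite mulr_ge0 ?powR_ge0.
have k0 : 0 <= k%:num by [].
have k1 : 0 <= 1 - k%:num by rewrite subr_ge0.
have hS : \sum_(e in E) w e `^ (k%:num * a + (1 - k%:num) * b) <=
    \sum_(e in E) A `^ k%:num * B `^ (1 - k%:num) *
      (k%:num * (w e `^ a / A) + (1 - k%:num) * (w e `^ b / B)).
  by apply: ler_sum => e _; exact: powR_conv_le_scaled.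
apply: (le_trans (ler_wpM2l c0 hS)); move: hA hB C0.
rewrite -mulr_sumr big_split/= -!mulr_sumr -!mulr_suml.
move: (_ * B `^ _) (\sum_(e in _) _) (\sum_(e in _) _) => C SB SA hA hB C0.
have -> : c * (C * (k%:num * (SA / A) + (1 - k%:num) * (SB / B))) =
    C * (k%:num * (c * SA / A) + (1 - k%:num) * (c * SB / B)).
  by ring.
have hA1 : c * SA / A <= 1 by rewrite ler_pdivrMr// mul1r.
have hB1 : c * SB / B <= 1 by rewrite ler_pdivrMr// mul1r.
have := ler_wpM2l C0 (lerD (ler_wpM2l k0 hA1) (ler_wpM2l k1 hB1)).
by rewrite !mulr1 subrKC mulr1.
Qed.

Lemma ln_le_conv (R : realType) (k A B T : R) : 0 < A -> 0 < B -> 0 < T ->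
  T <= A `^ k * B `^ (1 - k) -> ln T <= k * ln A + (1 - k) * ln B.
Proof.
move=> A0 B0 T0; rewrite -ler_ln ?posrE ?mulr_gt0 ?powR_gt0//.
by rewrite lnM ?posrE ?powR_gt0// !ln_powR.
Qed.

Lemma conv_gt0_le1 (R : realType) (k : {i01 R}) (a b : R) :
  0 < a <= 1 -> 0 < b <= 1 -> 0 < k%:num * a + (1 - k%:num) * b <= 1.
Proof.
move=> /andP[a0 a1] /andP[b0 b1]; apply/andP; split.
  by have := convR_gt0 k a0 b0; rewrite convRE.
have k1 : 0 <= 1 - k%:num by rewrite subr_ge0.
rewrite -[leRHS](subrKC k%:num 1) -[X in _ <= X + _]mulr1.
by rewrite -[X in _ <= _ + X]mulr1 lerD// ler_wpM2l.
Qed.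

Lemma prod_powR (R : realType) (I : finType) (A : {set I}) (F : I -> R) (a : R) :
  (forall i, 0 <= F i) ->
  \prod_(i in A) F i `^ a = (\prod_(i in A) F i) `^ a.
Proof.
move=> F0.
(* The induction carries nonnegativity of the partial product, which [powRM] requires. *)
suff [] : 0 <= \prod_(i in A) F i /\
  \prod_(i in A) F i `^ a = (\prod_(i in A) F i) `^ a by [].
elim/big_rec2: _ => [|i x y _ [x0 ->]]; first by rewrite powR1.
by rewrite powRM// mulr_ge0.
Qed.

Section spectral_radius.
Variables (R : realType) (n r : nat) (G : uhypergraph n r).
Implicit Types (p : R) (x : 'rV[R]_n).

Lemma polyform_le_spectral_radius p x : (0 < n)%N -> 1 <= p ->
  pnorm p x = 1 -> polyform G x <= spectral_radius G p.
Proof.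
move=> n0 p1 xp.
by have [y _ [<- ymax]] := @spectral_radius_max R n r G p n0 p1; exact: ymax.
Qed.

Lemma spectral_radius_gt0 p : (0 < n)%N -> (0 < r)%N -> 1 <= p ->
  edges G != finset.set0 -> 0 < spectral_radius G p.
Proof.
move=> n0 r0 p1 /set0Pn[e eG].
have p0 : 0 < p by exact: lt_le_trans p1.
(* The constant vector of unit norm: [c] solves [n * c^p = 1]. All its entries are positive, so a
   single edge makes the form positive. *)
pose c : R := n%:R^-1 `^ p^-1.
have c0 : 0 < c by rewrite powR_gt0// invr_gt0 ltr0n.
apply: lt_le_trans (@polyform_le_spectral_radius p (const_mx c) n0 p1 _).
  rewrite mulr_gt0 ?ltr0n// (bigD1 e)//= ltr_wpDr//.
    by apply: sumr_ge0 => f _; apply: prodr_ge0 => i _; rewrite mxE ltW.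
  by apply: prodr_gt0 => i _; rewrite mxE.
apply/(pnorm_eq1 p0); under eq_bigr do rewrite mxE gtr0_norm//.
rewrite sumr_const card_ord /c -powRrM mulVf ?gt_eqF// powRr1 ?invr_ge0//.
by rewrite -[LHS]mulr_natr mulVf// pnatr_eq0 -lt0n.
Qed.

(** Replacing each entry by its absolute value cannot decrease the form, and [|x_i|] is the [1/p]-th
    power of [|x_i|^p]. *)
Lemma polyform_le_powR p x : 0 < p ->
  polyform G x <=
  r%:R * \sum_(e in edges G) (\prod_(i in e) `|x ord0 i| `^ p) `^ p^-1.
Proof.
move=> p0; rewrite ler_wpM2l//; apply: ler_sum => e _.
apply: (le_trans (ler_norm _)).
rewrite normr_prod -prod_powR => [|i]; last exact: powR_ge0.
by apply: ler_prod => i _; rewrite normr_ge0 -powRrM mulfV ?gt_eqF// powRr1 ?lexx.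
Qed.

(** Decouples the two exponents: the simplex point obtained from a unit vector for [p] yields,
    raised to the power [a], a unit vector for [1/a]. *)
Lemma sum_powR_le_spectral_radius p (a : R) x : (0 < n)%N ->
  0 < a -> a <= 1 -> 0 < p -> pnorm p x = 1 ->
  r%:R * \sum_(e in edges G) (\prod_(i in e) `|x ord0 i| `^ p) `^ a
    <= spectral_radius G a^-1.
Proof.
move=> n0 a0 a1 p0 /(pnorm_eq1 p0) x1.
have -> : r%:R * \sum_(e in edges G) (\prod_(i in e) `|x ord0 i| `^ p) `^ a =
    polyform G (\row_i (`|x ord0 i| `^ p) `^ a).
  congr (_ * _); apply: eq_bigr => e _.
  rewrite -prod_powR => [|i]; last exact: powR_ge0.
  by apply: eq_bigr => i _; rewrite mxE.
apply: polyform_le_spectral_radius => //; first by rewrite invf_ge1.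
apply/pnorm_eq1; rewrite ?invr_gt0// -[RHS]x1.
apply: eq_bigr => i _; rewrite mxE ger0_norm ?powR_ge0// -powRrM.
by rewrite mulfV ?gt_eqF// powRr1// powR_ge0.
Qed.

Lemma spectral_radius_conv_le (k : {i01 R}) (a b : R) : (0 < n)%N -> (0 < r)%N ->
  edges G != finset.set0 -> 0 < a -> a <= 1 -> 0 < b -> b <= 1 ->
  spectral_radius G (k%:num * a + (1 - k%:num) * b)^-1 <=
  spectral_radius G a^-1 `^ k%:num * spectral_radius G b^-1 `^ (1 - k%:num).
Proof.
move=> n0 r0 G0 a0 a1 b0 b1.
set t := k%:num * a + _.
have /andP[t0 t1] : 0 < t <= 1 by apply: conv_gt0_le1; apply/andP.
set A := spectral_radius G a^-1; set B := spectral_radius G b^-1.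
have A0 : 0 < A by apply: spectral_radius_gt0; rewrite ?invf_ge1.
have B0 : 0 < B by apply: spectral_radius_gt0; rewrite ?invf_ge1.
have p0 : 0 < t^-1 by rewrite invr_gt0.
have p1 : 1 <= t^-1 by rewrite invf_ge1.
(* A maximiser at the intermediate exponent [t]; its simplex point is then tested at both [a] and
   [b]. *)
have [x x1 [<- _]] := @spectral_radius_max R n r G t^-1 n0 p1.
apply: (le_trans (@polyform_le_powR t^-1 x p0)); rewrite [t^-1^-1]invrK.
have := @sum_powR_le_spectral_radius _ a x n0 a0 a1 p0 x1.
have := @sum_powR_le_spectral_radius _ b x n0 b0 b1 p0 x1.
rewrite -/A -/B => hB hA; apply: sum_powR_conv_le => //; first by rewrite gt_eqF.
by move=> e; apply: prodr_ge0 => i _; exact: powR_ge0.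
Qed.

End spectral_radius.

Theorem theorem3p10 (R : realType) (n r : nat) (G : uhypergraph n r)
    (G0 : edges G != finset.set0) :
  convex_function (`]0, r%:R^-1[ : set R^o)
    (fun t : R^o => ln (spectral_radius G t^-1)).
Proof.
move=> k a b; rewrite !inE /= !in_itv /= => /andP[a0 ar] /andP[b0 br].
(* For [r = 0] the convention [0^-1 = 0] makes the interval empty. *)
have r0 : (0 < r)%N.
  by rewrite lt0n; apply/eqP => r0; move: (lt_trans a0 ar); rewrite r0 invr0 ltxx.
(* Some edge exists, and its [r > 0] elements are vertices. *)
have n0 : (0 < n)%N.
  have /set0Pn[e /edges_uniform er] := G0.
  by rewrite (leq_trans r0)// -er -[leqRHS]card_ord max_card.
(* Places [a] and [b] in [(0, 1]], so that the exponents [1/a] and [1/b] are at least 1 and the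
   maxima are attained. *)
have r1 : r%:R^-1 <= 1 :> R by rewrite invf_le1 ?ler1n ?ltr0n.
have a1 : a <= 1 by rewrite (le_trans (ltW ar)).
have b1 : b <= 1 by rewrite (le_trans (ltW br)).
have A0 : 0 < spectral_radius G a^-1 by apply: spectral_radius_gt0; rewrite ?invf_ge1.
have B0 : 0 < spectral_radius G b^-1 by apply: spectral_radius_gt0; rewrite ?invf_ge1.
have /andP[t0 t1] : 0 < k%:num * a + (1 - k%:num) * b <= 1.
  by apply: conv_gt0_le1; apply/andP.
have T0 : 0 < spectral_radius G (k%:num * a + (1 - k%:num) * b)^-1.
  by apply: spectral_radius_gt0; rewrite ?invf_ge1.
rewrite convRE; apply: ln_le_conv A0 B0 T0 _; exact: spectral_radius_conv_le.
Qed.
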